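(* Let $G$ be an abelian group that is not almost divisible. Then $$|\mathcal C(G)|=\chi(G,\gamma_G)=w(G,\gamma_G)=\omega\cdot\sup\{2^{|G/pG|}: p \text{ prime}\}.$$
   Context: $\mathcal C(G)$ is the family of all finite-index subgroups of $G$. The profinite topology $\gamma_G$ is the group topology on $G$ (not necessarily Hausdorff) having $\mathcal C(G)$ as a base of neighborhoods of $0$. The weight $w(G,\tau)$ of a topological group is the minimum cardinality of a base of the topology, and the local weight (character) $\chi(G,\tau)$ is the minimum cardinality of a base of neighborhoods of $0$. $D(G)$ denotes the largest divisible subgroup of $G$. An abelian group $G$ is almost divisible if $G/D(G)$ is finite; equivalently, if $\mathcal C(G)$ is finite. For an integer $m$, $mG=\{mx:x\in G\}$. *)

(* Defs.v *)
From HB Require Import structures.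
From mathcomp Require Import all_boot all_order all_algebra.
From mathcomp Require Import all_classical.
From mathcomp Require Import topology tvs.

Set Implicit Arguments.
Unset Strict Implicit.
Unset Printing Implicit Defensive.

Import GRing.Theory.

Local Open Scope ring_scope.
Local Open Scope classical_set_scope.
Local Open Scope card_scope.

Section cardinals.

(* There is no type of cardinals: a cardinal is represented by any set of that
   cardinality, and cardinals are compared by #= and #<=. *)

(* 2 ^ |A| *)
Definition subsets T (A : set T) : set (set T) := [set X | X `<=` A].

(* |K| is the minimum of the cardinalities |B|, for B ranging over P. *)
Definition is_min_card T U (P : set (set T)) (K : set U) : Prop :=
  (exists2 B, P B & B #= K) /\ (forall B, P B -> K #<= B).

(* |S| is the least upper bound of the cardinals |F i|, i in D; the upper
   bounds L range over sets in arbitrary types. *)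
Definition is_card_sup I T U (D : set I) (F : I -> set T) (S : set U) : Prop :=
  (forall i, D i -> F i #<= S) /\
  (forall (V : Type) (L : set V), (forall i, D i -> F i #<= L) -> S #<= L).

Lemma is_min_card_uniq T U V (P : set (set T)) (K : set U) (L : set V) :
  is_min_card P K -> is_min_card P L -> K #= L.
Proof.
move=> [[A PA /card_eqPle[AK _]] KP] [[B PB /card_eqPle[BL _]] LP].
apply/card_eqPle; split; first exact: card_le_trans (KP _ PB) BL.
exact: card_le_trans (LP _ PA) AK.
Qed.

Lemma is_card_sup_uniq I T U V (D : set I) (F : I -> set T)
    (S : set U) (S' : set V) :
  is_card_sup D F S -> is_card_sup D F S' -> S #= S'.
Proof.
move=> [FS leS] [FS' leS']; rewrite card_eq_le.
by apply/andP; split; [exact: leS|exact: leS'].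
Qed.

End cardinals.

Section topological_cardinal_invariants.
Context {T : topologicalType}.

Definition nbhs_basis (x : T) (B : set (set T)) : Prop :=
  B `<=` nbhs x /\ filter_from B id --> x.

Definition is_character (x : T) U (K : set U) : Prop :=
  is_min_card (nbhs_basis x) K.

Definition is_weight U (K : set U) : Prop := is_min_card (@basis T) K.

End topological_cardinal_invariants.
Arguments is_weight T {U} K.

Section abelian_groups.
Context {G : zmodType}.

Definition translate (H : set G) (x : G) : set G := [set x + h | h in H].

(* G/H *)
Definition cosets (H : set G) : set (set G) := range (translate H).

Definition subgroup (H : set G) : Prop := zmod_closed (mem H).

Definition multiples (m : nat) : set G := range (fun x : G => x *+ m).

Definition divisible_subgroup (H : set G) : Prop :=
  subgroup H /\
  (forall m, (0 < m)%N -> forall x, H x -> exists2 y, H y & y *+ m = x).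

End abelian_groups.

(* D(G), as the union of all divisible subgroups; it is the largest one by
   max_divisibleP and max_divisible_max. *)
Definition max_divisible (G : zmodType) : set G :=
  \bigcup_(H in divisible_subgroup) H.
Arguments max_divisible G : clear implicits.

Definition almost_divisible (G : zmodType) : Prop :=
  finite_set (cosets (max_divisible G)).

Definition finite_index_subgroups (G : zmodType) : set (set G) :=
  [set H | subgroup H /\ finite_set (cosets H)].
Arguments finite_index_subgroups G : clear implicits.

Section subgroup_lemmas.
Context {G : zmodType}.
Implicit Types H K : set G.

Lemma subgroupP H :
  subgroup H <-> H 0 /\ (forall x y, H x -> H y -> H (x - y)).
Proof.
split=> -[H0 HB]; split.
- by move: H0; rewrite inE.
- by move=> x y Hx Hy; have := HB x y; rewrite !inE; apply.
- by rewrite inE.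
- by move=> x y; rewrite !inE; exact: HB.
Qed.

Lemma subgroup0 H : subgroup H -> H 0.
Proof. by case/subgroupP. Qed.

Lemma subgroupB H x y : subgroup H -> H x -> H y -> H (x - y).
Proof. by case/subgroupP=> _; apply. Qed.

Lemma subgroupN H x : subgroup H -> H x -> H (- x).
Proof.
by move=> sH Hx; rewrite -(sub0r x); exact: (subgroupB sH (subgroup0 sH) Hx).
Qed.

Lemma subgroupD H x y : subgroup H -> H x -> H y -> H (x + y).
Proof.
move=> sH Hx Hy; rewrite -(opprK y).
exact: (subgroupB sH Hx (subgroupN sH Hy)).
Qed.

Lemma max_divisible_max H :
  divisible_subgroup H -> H `<=` max_divisible G.
Proof. by move=> dH x Hx; exists H. Qed.

Lemma max_divisibleP : divisible_subgroup (max_divisible G).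
Proof.
split.
  apply/subgroupP; split.
    exists [set 0] => //; split.
      by apply/subgroupP; split=> // x y /= -> ->; rewrite subr0.
    by move=> m _ x ->; exists 0 => //; rewrite mul0rn.
  move=> x y [H [sH dH] Hx] [K [sK dK] Ky].
  exists [set z | exists2 u, H u & exists2 v, K v & z = u - v]; last first.
    by exists x => //; exists y.
  split.
    apply/subgroupP; split.
      exists 0; first exact: subgroup0.
      by exists 0; [exact: subgroup0|rewrite subr0].
    move=> _ _ [u Hu [v Kv ->]] [u' Hu' [v' Kv' ->]].
    exists (u - u'); first exact: subgroupB.
    exists (v - v'); first exact: subgroupB.
    by rewrite !opprB [v' - u']addrC addrACA [v' - v]addrC.
  move=> m m0 _ [u Hu [v Kv ->]].
  have [a Ha <-] := dH m m0 u Hu; have [b Kb <-] := dK m m0 v Kv.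
  by exists (a - b); [exists a => //; exists b|rewrite mulrnBl].
move=> m m0 x [H dH Hx]; case: (dH) => _ /(_ m m0 x Hx) [y Hy <-].
by exists y => //; exists H.
Qed.

Lemma mem_translate H x y : translate H x y <-> H (y - x).
Proof.
split; first by move=> [h Hh <-]; rewrite addrAC subrr add0r.
by move=> Hxy; exists (y - x) => //; rewrite addrC subrK.
Qed.

Lemma translate0 H : translate H 0 = H.
Proof. by apply/seteqP; split=> y; rewrite mem_translate subr0. Qed.

Lemma translate_refl H x : subgroup H -> translate H x x.
Proof. by move=> sH; apply/mem_translate; rewrite subrr; exact: subgroup0. Qed.

Lemma finite_index_subgroupsT : finite_index_subgroups G setT.
Proof.
split; first by apply/subgroupP.
apply: (@sub_finite_set _ _ [set setT]); last exact: finite_set1.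
by move=> _ [x _ <-]; apply/seteqP; split=> y // _; apply/mem_translate.
Qed.

Lemma finite_index_subgroupsI H K :
  finite_index_subgroups G H -> finite_index_subgroups G K ->
  finite_index_subgroups G (H `&` K).
Proof.
move=> [sH fH] [sK fK]; split.
  apply/subgroupP; split; first by split; exact: subgroup0.
  by move=> x y [Hx Kx] [Hy Ky]; split; exact: subgroupB.
apply: (@sub_finite_set _ _
    [set A `&` B | A in cosets H & B in cosets K]); last first.
  exact: finite_image2.
move=> _ [x _ <-]; exists (translate H x); first by exists x.
exists (translate K x); first by exists x.
by apply/seteqP; split=> y /=; rewrite !mem_translate.
Qed.

End subgroup_lemmas.

(* A copy of G carrying the profinite topology. *)
Definition profinite (G : zmodType) : Type := G.

HB.instance Definition _ (G : zmodType) := GRing.Zmodule.on (profinite G).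

Section profinite_topology.
Context {G : zmodType}.

Definition profinite_nbhs (x : profinite G) : set_system (profinite G) :=
  filter_from (finite_index_subgroups G) (fun H => translate H x).

HB.instance Definition _ := hasNbhs.Build (profinite G) profinite_nbhs.

Let nbhs_filter (x : profinite G) : ProperFilter (nbhs x).
Proof.
apply: filter_from_proper; last first.
  by move=> H [sH _]; exists x; exact: translate_refl.
apply: filter_from_filter; first by exists setT; exact: finite_index_subgroupsT.
move=> H K CH CK; exists (H `&` K); first exact: finite_index_subgroupsI.
by move=> y /mem_translate [Hy Ky]; split; apply/mem_translate.
Qed.

Let nbhs_singleton (x : profinite G) (A : set (profinite G)) :
  nbhs x A -> A x.
Proof. by move=> [H [sH _]]; apply; exact: translate_refl. Qed.

Let nbhs_nbhs (x : profinite G) (A : set (profinite G)) :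
  nbhs x A -> nbhs x (nbhs^~ A).
Proof.
move=> [H CH HA]; exists H => // y /mem_translate Hyx; exists H => //.
move=> z /mem_translate Hzy; apply/HA/mem_translate.
by rewrite -(subrK y z) -addrA; case: CH => sH _; exact: subgroupD.
Qed.

HB.instance Definition _ := Nbhs_isNbhsTopological.Build (profinite G)
  nbhs_filter nbhs_singleton nbhs_nbhs.

Let sub_continuous :
  continuous (fun x : profinite G * profinite G => x.1 - x.2).
Proof.
move=> -[x y] /= A [H CH HA].
exists (translate H x, translate H y); first by split; exists H.
move=> [u v] /= [/mem_translate Hu /mem_translate Hv]; apply/HA/mem_translate.
have -> : u - v - (x - y) = (u - x) - (v - y).
  by rewrite !opprB [y - x]addrC addrACA [y - v]addrC.
by case: CH => sH _; exact: subgroupB.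
Qed.

HB.instance Definition _ :=
  PreTopologicalNmodule_isTopologicalZmodule.Build (profinite G) sub_continuous.

Lemma nbhs_basis_profinite :
  nbhs_basis (0 : profinite G) (finite_index_subgroups G).
Proof.
split=> [H CH|A [H CH HA]].
  by exists H => //; rewrite translate0.
by exists H => //; rewrite translate0 in HA.
Qed.

End profinite_topology.

(* Main.v *)
(* Write C(G) for the set of subgroups of finite index.

   Lower bound. If G/pG is infinite, it has an F_p-basis B with
   |B| = |G/pG|, and each X in 2^B gives a finite-index subgroup, the kernel of
   the functional G -> F_p that is the indicator of X on B. If all G/pG are
   finite, then all G/mG (m > 0) are; if C(G) were finite, all its members
   would contain NG for some N > 0, so NG would be contained in mNG for all
   m > 0, hence be divisible, and G would be almost divisible.

   Upper bound. A finite-index subgroup K contains nG for some n > 0, and the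
   projection G -> G/K is determined by its values on transversals of the pG
   with p | n, because these generate G modulo nG. So K is coded by a natural
   number and a finite sequence of subsets of the G/pG.

   Topology. Every member of a base B of neighborhoods of 0 contains a
   finite-index subgroup, which lies in only finitely many subgroups; as every K
   in C(G) contains a member of B, |C(G)| <= omega * |B|. *)
Require Import Defs.
From mathcomp Require Import all_boot all_order all_algebra.
From mathcomp Require Import all_classical.
From mathcomp Require Import topology tvs.

Set Implicit Arguments.
Unset Strict Implicit.
Unset Printing Implicit Defensive.

Import GRing.Theory.

Local Open Scope ring_scope.
Local Open Scope classical_set_scope.
Local Open Scope card_scope.

(** * Cardinal arithmetic *)

Section cardinal_arithmetic.

(** The code [y] of [x] may depend on choices made for [x], as long as it determines [x]; the axiom
    of choice extracts an injection. *)
Lemma card_le_rel T U (A : set T) (B : set U) (R : T -> U -> Prop) :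
  (forall x, A x -> exists2 y, B y & R x y) ->
  (forall x x' y, A x -> A x' -> B y -> R x y -> R x' y -> x = x') ->
  A #<= B.
Proof.
move=> RB Rinj; have [->|/set0P[x0 Ax0]] := eqVneq A set0.
  exact: card_ge0.
have [y0 _ _] := RB _ Ax0.
have /choice[f fP] : forall x, exists y, A x -> B y /\ R x y.
  move=> x; have [Ax|nAx] := pselect (A x); last by exists y0.
  by have [y By Rxy] := RB _ Ax; exists y.
have /injfunPex[g] : exists2 f : T -> U, set_fun A B f & set_inj A f.
  exists f => [x Ax|x x' /set_mem Ax /set_mem Ax' eff]; first by case: (fP x Ax).
  have [Bfx Rx] := fP x Ax; have [_ Rx'] := fP x' Ax'.
  by apply: (Rinj _ _ _ Ax Ax' Bfx Rx); rewrite eff.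
exact: inj_card_le g.
Qed.

Lemma card_le_fun T U (A : set T) (B : set U) (f : T -> U) :
  (forall x, A x -> B (f x)) ->
  (forall x x', A x -> A x' -> f x = f x' -> x = x') -> A #<= B.
Proof.
move=> fB finj; apply: (@card_le_rel _ _ _ _ (fun x y => f x = y)).
  by move=> x Ax; exists (f x) => //; exact: fB.
by move=> x x' y Ax Ax' _ <- /esym; exact: finj.
Qed.

(** Nonemptiness of [A] makes [U] inhabited, so that [f] can be total on [T]. *)
Lemma card_le_funP T U (A : set T) (B : set U) : A !=set0 -> A #<= B ->
  exists f : T -> U, (forall x, A x -> B (f x)) /\
    (forall x x', A x -> A x' -> f x = f x' -> x = x').
Proof.
elim/Ppointed: U => U in B *.
  by move=> [x Ax]; rewrite emptyE => /eqP A0; rewrite A0 in Ax.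
move=> _ /pcard_leP/injfunPex[f fB finj].
exists f; split=> [x|x x' Ax Ax']; first exact: fB.
by apply: finj; rewrite inE.
Qed.

Lemma card_le_setX T T' U U' (A : set T) (A' : set T') (B : set U)
    (B' : set U') : A #<= B -> A' #<= B' -> A `*` A' #<= B `*` B'.
Proof.
have [->|/set0P A0 AB] := eqVneq A set0; first by rewrite set0X => *; exact: card_ge0.
have [->|/set0P A'0 AB'] := eqVneq A' set0; first by rewrite setX0 card_ge0.
have [f [fB finj]] := card_le_funP A0 AB.
have [g [gB ginj]] := card_le_funP A'0 AB'.
apply: (@card_le_fun _ _ _ _ (fun x => (f x.1, g x.2))).
  by move=> [x y] [/= Ax Ay]; split; [exact: fB|exact: gB].
move=> [x y] [x' y'] [/= Ax Ay] [/= Ax' Ay'] [/finj -> // /ginj -> //].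
Qed.

(** By Zorn there is a maximal partial injection, encoded by its graph. It is defined on all of [A]
    or hits all of [B], since otherwise an unmatched pair could be added. *)
Lemma card_le_total T U (A : set T) (B : set U) : A #<= B \/ B #<= A.
Proof.
pose P (R : set (T * U)) := [/\ R `<=` A `*` B,
  (forall x y y', R (x, y) -> R (x, y') -> y = y') &
  (forall x x' y, R (x, y) -> R (x', y) -> x = x')].
have [F FP Ftot|R [[RAB Rfun Rinj] Rmax]] := @Zorn_bigcup (T * U) P.
  split=> [z [R /FP[RAB _ _] /RAB]//|x y y'|x x' y] [R FR Rxy] [R' FR' Rxy'].
    have [RR'|R'R] := Ftot _ _ FR FR'.
      by have [_ + _] := FP _ FR'; apply; [exact: RR' Rxy|exact: Rxy'].
    by have [_ + _] := FP _ FR; apply; [exact: Rxy|exact: R'R Rxy'].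
  have [RR'|R'R] := Ftot _ _ FR FR'.
    by have [_ _] := FP _ FR'; apply; [exact: RR' Rxy|exact: Rxy'].
  by have [_ _] := FP _ FR; apply; [exact: Rxy|exact: R'R Rxy'].
have [AR|/existsNP[a /not_implyP[Aa /forallNP aR]]] :=
    pselect (forall x, A x -> exists y, R (x, y)).
  left; apply: (@card_le_rel _ _ _ _ (fun x y => R (x, y))).
    by move=> x /AR[y Rxy]; exists y => //; have [] := RAB _ Rxy.
  by move=> x x' y _ _ _; exact: Rinj.
have [BR|/existsNP[b /not_implyP[Bb /forallNP bR]]] :=
    pselect (forall y, B y -> exists x, R (x, y)).
  right; apply: (@card_le_rel _ _ _ _ (fun y x => R (x, y))).
    by move=> y /BR[x Rxy]; exists x => //; have [] := RAB _ Rxy.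
  by move=> y y' x _ _ _; exact: Rfun.
exfalso; apply: (Rmax (R `|` [set (a, b)])).
  by split=> [|RE]; [exact: subsetUl|apply/(aR b)/RE; right].
split=> [z [/RAB//|->//]|x y y'|x x' y].
- move=> [Rxy|[-> ->]] [Rxy'|[]]; first exact: Rfun Rxy Rxy'.
  + by move=> xa _; rewrite xa in Rxy; case: (aR _ Rxy).
  + by case: (aR _ Rxy').
  + by [].
- move=> [Rxy|[-> ->]] [Rxy'|[]]; first exact: Rinj Rxy Rxy'.
  + by move=> _ yb; rewrite yb in Rxy; case: (bR _ Rxy).
  + by case: (bR _ Rxy').
  + by [].
Qed.

(* A maximal C with an injection f of C * C into C exists by Zorn. If A \ C
   were larger than C, it would contain a copy of C, and f could be extended to
   the union of C and this copy; so A \ C embeds in C, and then A does. *)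
Lemma card_le_sqr T (A : set T) : infinite_set A -> A `*` A #<= A.
Proof.
move=> /infiniteP/card_le_funP[|e [eA einj]]; first by exists 0%N.
(* The pairs (C, f) to which Zorn's lemma is applied. The distinct elements [e 0%N] and [e 1%N] of C
   will serve as tags. *)
pose good (p : set T * (T -> T -> T)) :=
  [/\ p.1 `<=` A, p.1 (e 0%N) /\ p.1 (e 1%N),
      (forall x y, p.1 x -> p.1 y -> p.1 (p.2 x y)) &
      (forall x y x' y', p.1 x -> p.1 y -> p.1 x' -> p.1 y' ->
        p.2 x y = p.2 x' y' -> x = x' /\ y = y')].
pose R (p q : {p | good p}) := `[< (sval p).1 `<=` (sval q).1 /\
  forall x y, (sval p).1 x -> (sval p).1 y ->
    (sval p).2 x y = (sval q).2 x y >].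
have /choice[d dP] : forall x, exists n, forall m, e m = x -> n = m.
  move=> x; have [[n <-]|nx] := pselect (exists n, e n = x).
    by exists n => m /einj ->.
  by exists 0%N => m emx; case: nx; exists m.
(* Starting point: a countable subset of A, with the pairing of natural numbers carried over by [e]
   and its left inverse [d]. *)
have good0 : good (range e, fun x y => e (pickle (d x, d y))).
  split=> //=; first by move=> _ [n _ <-]; exact: eA.
    by split; [exists 0%N|exists 1%N].
    by move=> x y _ _; eexists.
  move=> _ _ _ _ [i _ <-] [j _ <-] [i' _ <-] [j' _ <-].
  by rewrite !(dP _ _ erefl) => /einj-/(_ I I)/(pcan_inj pickleK)[-> ->].
have [//||F Ftot|[[C f] /=]] := @ZL_preorder {p | good p} (exist _ _ good0) R.
- by move=> p; apply/asboolP; split.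
- move=> q p r /asboolP[pq fpq] /asboolP[qr fqr]; apply/asboolP.
  split=> [x /pq/qr//|x y px py].
  by rewrite fpq// fqr//; exact: pq.
- have [[p0 Fp0]|F0] := pselect (exists p, F p); last first.
    by exists (exist _ _ good0) => p Fp; case: F0; exists p.
  have Fmax p q : F p -> F q -> exists r, [/\ F r, R p r & R q r].
    have Rxx r : R r r by apply/asboolP; split.
    by move=> Fp Fq; have [pq|qp] := Ftot _ _ Fp Fq; [exists q|exists p].
  (* The functions of a chain agree on common domains, so they glue; elsewhere the value is
     arbitrary. *)
  have /choice[h hP] : forall xy : T * T, exists z, forall p, F p ->
      (sval p).1 xy.1 -> (sval p).1 xy.2 -> z = (sval p).2 xy.1 xy.2.
    move=> [x y] /=.
    have [[p [Fp px py]]|np] :=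
        pselect (exists p, [/\ F p, (sval p).1 x & (sval p).1 y]).
      exists ((sval p).2 x y) => q Fq qx qy.
      have [r [_ /asboolP[_ pr] /asboolP[_ qr]]] := Fmax _ _ Fp Fq.
      by rewrite pr// qr.
    by exists x => p Fp px py; case: np; exists p.
  pose D := \bigcup_(p in F) (sval p).1.
  have D2 x y : D x -> D y ->
      exists r, [/\ F r, (sval r).1 x & (sval r).1 y].
    move=> [p Fp px] [q Fq qy].
    have [r [Fr /asboolP[pr _] /asboolP[qr _]]] := Fmax _ _ Fp Fq.
    by exists r; split=> //; [exact: pr|exact: qr].
  have goodD : good (D, fun x y => h (x, y)).
    split=> /=.
    - by move=> x [p Fp px]; case: (svalP p) => + _ _ _; apply.
    - by case: (svalP p0) => _ [p0a p0b] _ _; split; exists p0.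
    - move=> x y /D2/[apply] -[r [Fr rx ry]]; exists r => //.
      by rewrite (hP (x, y) r)//; case: (svalP r) => _ _ + _; apply.
    - move=> x y x' y' Dx Dy Dx' Dy'.
      have [r [Fr rx ry]] := D2 _ _ Dx Dy.
      have [r' [Fr' rx' ry']] := D2 _ _ Dx' Dy'.
      have [s [Fs /asboolP[rs _] /asboolP[rs' _]]] := Fmax _ _ Fr Fr'.
      rewrite (hP (x, y) s)//= ?(hP (x', y') s)//=; try exact: rs; try exact: rs'.
      by case: (svalP s) => _ _ _; apply; try exact: rs; exact: rs'.
  exists (exist _ _ goodD) => p Fp; apply/asboolP; split=> /= [x px|x y px py].
    by exists p.
  by rewrite (hP (x, y) p).
move=> Cgood Cmax; case: (Cgood) => /= CA [Ca Cb] fC finj.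
have ab : e 0%N <> e 1%N by move=> /einj-/(_ I I).
(* Two copies of C fit into C through [f]: elements of C are tagged by [e 0%N], the others by
   [e 1%N]. *)
have inj_u (X : set T) (i : T -> T) :
    (forall x, X x -> ~ C x -> C (i x)) ->
    (forall x y, X x -> ~ C x -> X y -> ~ C y -> i x = i y -> x = y) ->
    exists u : T -> T, (forall x, X x -> C (u x)) /\
      (forall x y, X x -> X y -> u x = u y -> x = y).
  move=> iC iinj.
  pose u x := if `[< C x >] then f (e 0%N) x else f (e 1%N) (i x).
  exists u; rewrite /u; split=> [x Xx|x y Xx Xy].
    by case: asboolP => Cx; apply: fC => //; exact: iC.
  case: asboolP => Cx; case: asboolP => Cy /finj[]//; try exact: iC.
  - by move=> /esym.
  - by move=> _ /iinj; apply.
suff [u [uC uinj]] : exists u : T -> T, (forall x, A x -> C (u x)) /\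
    (forall x y, A x -> A y -> u x = u y -> x = y).
  apply: (@card_le_fun _ _ _ _ (fun z => f (u z.1) (u z.2))).
    by move=> [x y] [/= Ax Ay]; apply/CA/fC; exact: uC.
  move=> [x y] [x' y'] [/= Ax Ay] [/= Ax' Ay'].
  by move=> /finj[]; try exact: uC; move=> /uinj -> // /uinj ->.
have [ACle|] := card_le_total (A `\` C) C.
  have [AC0|/set0P AC0] := eqVneq (A `\` C) set0.
    have AC x : A x -> C x.
      by move=> Ax; apply: contrapT => nCx; rewrite -[False]/(set0 x) -AC0.
    by exists id; split.
  have [i [iC iinj]] := card_le_funP AC0 ACle.
  by apply: (inj_u A i) => [x ? ?|x y ? ? ? ?]; [exact: iC|apply: iinj].
move=> /card_le_funP[|j [jAC jinj]]; first by exists (e 0%N).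
exfalso.
have /choice[k kP] : forall y, exists x, forall z, C z -> j z = y -> x = z.
  move=> y; have [[x Cx <-]|nx] := pselect (exists2 x, C x & j x = y).
    by exists x => z Cz /jinj ->.
  by exists y => z Cz jzy; case: nx; exists z.
pose X := C `|` j @` C.
have [u [uC uinj]] : exists u : T -> T, (forall x, X x -> C (u x)) /\
    (forall x y, X x -> X y -> u x = u y -> x = y).
  have XC x : X x -> ~ C x -> exists2 z, C z & j z = x by case.
  apply: (inj_u X k) => [x /XC/[apply] -[z Cz zx]|x y].
    by rewrite (kP _ _ Cz zx).
  move=> /XC/[apply] -[z Cz zx] /XC/[apply] -[t Ct ty].
  by rewrite (kP _ _ Cz zx) (kP _ _ Ct ty) -zx -ty => ->.
(* Pairs not both in C are sent into the copy of C under [j], which is disjoint from C; so [g]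
   extends [f] and stays injective. *)
pose g x y := if `[< C x /\ C y >] then f x y else j (f (u x) (u y)).
have Xgood : good (X, g).
  split=> /=.
  - by move=> x [/CA//|[z /jAC[Az _] <-]].
  - by split; left.
  - move=> x y Xx Xy; rewrite /g; case: asboolP => [[Cx Cy]|_].
      by left; exact: fC.
    by right; exists (f (u x) (u y)) => //; apply: fC; exact: uC.
  - move=> x y x' y' Xx Xy Xx' Xy'; rewrite /g.
    have Cfu a b : X a -> X b -> C (f (u a) (u b)) by move=> *; apply: fC; exact: uC.
    case: asboolP => [[Cx Cy]|_]; case: asboolP => [[Cx' Cy']|_].
    + exact: finj.
    + move=> fj; have [_ []] := jAC _ (Cfu _ _ Xx' Xy').
      by rewrite -fj; exact: fC.
    + move=> fj; have [_ []] := jAC _ (Cfu _ _ Xx Xy).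
      by rewrite fj; exact: fC.
    + move=> /jinj-/(_ (Cfu _ _ Xx Xy) (Cfu _ _ Xx' Xy')) /finj[]; try exact: uC.
      by move=> /uinj -> // /uinj ->.
(* Maximality would put X inside C, but [j (e 0%N)] lies in X and not in C. *)
have /asboolP[/= XC _] : R (exist _ _ Xgood) (exist _ _ Cgood).
  apply: Cmax; apply/asboolP; split=> /= [x Cx|x y Cx Cy]; first by left.
  by rewrite /g; case: asboolP => // -[].
have [_ []] := jAC _ Ca; apply: XC; right; by exists (e 0%N).
Qed.

Lemma finite_card_le T U (A : set T) (B : set U) :
  finite_set A -> infinite_set B -> A #<= B.
Proof.
by move=> /finite_set_countable Anat /infiniteP; exact: card_le_trans.
Qed.

Lemma card_le_nat_setX T (A : set T) :
  infinite_set A -> [set: nat] `*` A #<= A.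
Proof.
move=> Ainf; apply: card_le_trans (card_le_sqr Ainf).
by apply: card_le_setX (card_lexx _); exact/infiniteP.
Qed.

(** The nested pairing [enc] is injective only among sequences of equal length, so the length is
    stored as well, as [e (size s)]. *)
Lemma card_le_seq T (A : set T) :
  infinite_set A -> [set s | all (mem A) s] #<= A.
Proof.
move=> Ainf; have /infiniteP/card_le_funP[|e [eA einj]] := Ainf.
  by exists 0%N.
have /card_le_funP[|g [gA ginj]] := card_le_sqr Ainf.
  by exists (e 0%N, e 0%N); split; exact: eA.
have {}gA x y : A x -> A y -> A (g (x, y)) by move=> Ax Ay; apply: gA.
have {}ginj x y x' y' : A x -> A y -> A x' -> A y' ->
    g (x, y) = g (x', y') -> x = x' /\ y = y'.
  move=> Ax Ay Ax' Ay'.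
  by move=> /(ginj (x, y) (x', y') (conj Ax Ay) (conj Ax' Ay'))[].
pose enc := foldr (fun x a => g (x, a)) (e 0%N).
have encA s : all (mem A) s -> A (enc s).
  elim: s => [_|x s IHs /= /andP[/set_mem Ax /IHs As]]; first exact: eA.
  exact: gA.
have enc_inj s t : all (mem A) s -> all (mem A) t -> size s = size t ->
    enc s = enc t -> s = t.
  elim: s t => [|x s IHs] [|y t] //= /andP[/set_mem Ax As].
  move=> /andP[/set_mem Ay At] [st] /ginj[]; try exact: encA; try by [].
  by move=> -> /IHs ->.
apply: (@card_le_fun _ _ _ _ (fun s => g (e (size s), enc s))).
  by move=> s As; apply: gA; [exact: eA|exact: encA].
move=> s t As At /ginj[]; try exact: eA; try exact: encA.
by move=> /einj-/(_ I I) st; exact: enc_inj.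
Qed.

Lemma card_le_subsets T U (A : set T) (B : set U) :
  A #<= B -> subsets A #<= subsets B.
Proof.
have [->|/set0P A0 AB] := eqVneq A set0.
  move=> _; apply: (@card_le_fun _ _ _ _ (fun=> set0)) => [X _ //|X Y].
  by rewrite /subsets /= !subset0 => -> ->.
have [f [fB finj]] := card_le_funP A0 AB.
apply: (@card_le_fun _ _ _ _ (fun X => f @` X)) => [X XA _ [x /XA Ax <-]|X Y].
  exact: fB.
have XY X' Y' : X' `<=` A -> Y' `<=` A -> f @` X' = f @` Y' -> X' `<=` Y'.
  move=> XA YA fXY x Xx; have [y Yy /finj] : (f @` Y') (f x).
    by rewrite -fXY; exists x.
  by move=> <- //; [exact: YA|exact: XA].
by move=> XA YA fXY; apply/seteqP; split; apply: XY.
Qed.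

Lemma infinite_subsets T (A : set T) :
  infinite_set A -> infinite_set (subsets A).
Proof.
move=> Ainf; apply: contra_not Ainf; apply: card_le_finite.
apply: (@card_le_fun _ _ _ _ (fun x => [set x])) => [x Ax _ -> //|x y _ _].
by move=> xy; have : [set y] x by rewrite -xy.
Qed.

Lemma finite_subsets T (A : set T) : finite_set A -> finite_set (subsets A).
Proof.
move=> [n /card_eqPle[An _]].
apply: card_le_finite (card_le_subsets An) _.
apply: (@card_le_finite _ {set 'I_n} _ setT); last exact: finite_finset.
apply: (@card_le_fun _ _ _ _
  (fun X : set nat => [set i : 'I_n | `[< X i >]]%SET)) => // X Y XI YI.
move=> /setP XY; apply/seteqP; split=> i Zi.
  by move: (XY (Ordinal (XI _ Zi))); rewrite !inE asboolT// => /esym/asboolP.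
by move: (XY (Ordinal (YI _ Zi))); rewrite !inE [RHS]asboolT// => /asboolP.
Qed.

(** If one natural number bounds every |F i|, the least such bound is the supremum. Otherwise every
    upper bound is infinite, absorbs a factor omega, and so dominates the disjoint union of the F
    i. *)
Lemma card_sup_exists T (D : set nat) (F : nat -> set T) :
  exists U (S : set U), is_card_sup D F S.
Proof.
have [[n Fn]|Fn] := pselect (exists n, forall i, D i -> F i #<= `I_n).
  have exn : exists n, `[< forall i, D i -> F i #<= `I_n >].
    by exists n; exact/asboolP.
  case: (ex_minnP exn) => m /asboolP Fm mmin.
  exists nat, `I_m; split=> // V L FL.
  have [[k /card_eqPle[Lk kL]]|Linf] := pselect (finite_set L).
    apply: card_le_trans kL; rewrite card_le_II; apply/mmin/asboolP => i Di.
    exact: card_le_trans (FL i Di) Lk.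
  exact/finite_card_le.
exists _, (\bigcup_(i in D) [set (i, x) | x in F i]); split=> [i Di|V L FL].
  apply: (@card_le_fun _ _ _ _ (fun x => (i, x))) => [x Fx|x y _ _ []//].
  by exists i => //; exists x.
have Linf : infinite_set L.
  move=> [n /card_eqPle[Ln _]]; apply: Fn; exists n => i Di.
  exact: card_le_trans (FL i Di) Ln.
apply: card_le_trans (card_le_nat_setX Linf).
have /choice[f fP] : forall i, exists R : T -> V -> Prop, D i ->
    (forall x, F i x -> exists2 y, L y & R x y) /\
    (forall x x' y, F i x -> F i x' -> R x y -> R x' y -> x = x').
  move=> i; have [Di|nDi] := pselect (D i); last by exists (fun _ _ => True).
  have [F0|/set0P F0] := eqVneq (F i) set0.
    by exists (fun _ _ => True) => _; rewrite F0; split.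
  have [g [gL ginj]] := card_le_funP F0 (FL i Di).
  exists (fun x y => g x = y) => _; split=> [x Fx|x x' y Fx Fx' <- /esym].
    by exists (g x) => //; exact: gL.
  exact: ginj.
apply: (@card_le_rel _ _ _ _ (fun z t => z.1 = t.1 /\ f z.1 z.2 t.2)).
  move=> _ [i Di [x Fx <-]]; have [/(_ x Fx)[y Ly fxy] _] := fP i Di.
  by exists (i, y).
move=> _ _ [j y] [i Di [x Fx <-]] [i' _ [x' Fx' <-]] _ /= [ij fx] [ij' fx'].
move: ij ij' Di Fx Fx' fx fx' => -> -> Dj Fx Fx' fx fx'.
by have [_ finj] := fP j Dj; rewrite (finj _ _ _ Fx Fx' fx fx').
Qed.

End cardinal_arithmetic.

(** * Subgroups of finite index *)

Section finite_index.
Context {G : zmodType}.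
Implicit Types K H : set G.

Lemma subgroupMn H x n : subgroup H -> H x -> H (x *+ n).
Proof.
move=> sH Hx; elim: n => [|n IHn]; first by rewrite mulr0n; exact: subgroup0.
by rewrite mulrS; exact: subgroupD.
Qed.

Lemma subgroup_sum H (s : seq G) (F : G -> G) : subgroup H ->
  (forall x, x \in s -> H (F x)) -> H (\sum_(x <- s) F x).
Proof.
move=> sH HF; rewrite big_seq; apply: big_ind => //; first exact: subgroup0.
by move=> x y; exact: subgroupD.
Qed.

Lemma translate_eqP K x y :
  subgroup K -> translate K x = translate K y <-> K (y - x).
Proof.
move=> sK; split=> [xy|Kyx].
  by apply/mem_translate; rewrite xy; exact: translate_refl.
apply/seteqP; split=> z /mem_translate Kz; apply/mem_translate.
  rewrite -(subrKA x); apply: subgroupD => //.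
  by rewrite -opprB; exact: subgroupN.
by rewrite -(subrKA y); exact: subgroupD.
Qed.

Lemma multiples_subgroup m : subgroup (@multiples G m).
Proof.
apply/subgroupP; split; first by exists 0 => //; rewrite mul0rn.
by move=> _ _ [x _ <-] [y _ <-]; exists (x - y) => //; rewrite mulrnBl.
Qed.

(** The label [l] has to separate the cosets but need not be constant on them. *)
Lemma card_cosets_le T (A : set T) (l : G -> T) K : subgroup K ->
  (forall x, A (l x)) -> (forall x y, l x = l y -> K (y - x)) ->
  cosets K #<= A.
Proof.
move=> sK lA lK; apply: (@card_le_rel _ _ _ _
    (fun c t => exists2 x, c = translate K x & t = l x)).
  by move=> _ [x _ <-]; exists (l x) => //; exists x.
move=> _ _ t _ _ _ [x -> ->] [y -> lxy]; exact/translate_eqP/lK.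
Qed.

(** The numbering [l] stands in for the quotient map G -> G/K. *)
Lemma finite_cosets_label K : subgroup K -> finite_set (cosets K) ->
  exists m (l : G -> nat), (forall x, (l x < m)%N) /\
    (forall x y, l x = l y <-> K (y - x)).
Proof.
move=> sK [m /card_eqPle[Km _]].
have [|f [fm finj]] := card_le_funP _ Km; first by exists (translate K 0), 0.
exists m, (fun x => f (translate K x)); split=> [x|x y].
  by apply: fm; exists x.
rewrite -translate_eqP//; split=> [|-> //].
by apply: finj; [exists x|exists y].
Qed.

Lemma finite_cosets_sub H K : subgroup H -> subgroup K -> H `<=` K ->
  finite_set (cosets H) -> finite_set (cosets K).
Proof.
move=> sH sK HK /(finite_cosets_label sH)[m [l [lm lH]]].
apply: card_le_finite (card_cosets_le (A := `I_m) (l := l) sK _ _) (finite_II m).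
  exact: lm.
by move=> x y /lH/HK.
Qed.

(** Pigeonhole: two of the multiples 0, x, ..., mx share one of the m labels, so K contains (j - i)x
    with 0 < j - i <= m, hence m!x. *)
Lemma finite_index_multiples K : finite_index_subgroups G K ->
  exists2 n, (0 < n)%N & @multiples G n `<=` K.
Proof.
move=> [sK /(finite_cosets_label sK)[m [l [lm lK]]]].
exists m`!; first exact: fact_gt0.
move=> _ [x _ <-].
pose f (i : 'I_m.+1) : 'I_m := Ordinal (lm (x *+ i)).
have /injectivePn[i [j]] : ~~ injectiveb f.
  apply/negP => /injectiveP/leq_card; by rewrite !card_ord ltnn.
wlog ij : i j / (i < j)%N => [hw ne fij|].
  have := ne; rewrite neq_ltn => /orP[] ?; first exact: (hw i j).
  by apply: (hw j i) => //; rewrite eq_sym.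
move=> _ /(congr1 val) /= /lK; rewrite -mulrnBr; last exact: ltnW.
move=> Kx; have /dvdnP[q ->] : (j - i %| m`!)%N.
  apply: dvdn_fact; rewrite subn_gt0 ij leq_subLR.
  by rewrite (leq_trans (leq_ord j))// leq_addl.
by rewrite mulnC mulrnA; exact: subgroupMn.
Qed.

(** Induction on m = kp: if r represents x modulo kG and x - r = kd, the class of x modulo mG is
    determined by r and the class of d modulo pG. *)
Lemma finite_cosets_multiples :
  (forall p, prime p -> finite_set (cosets (@multiples G p))) ->
  forall m, (0 < m)%N -> finite_set (cosets (@multiples G m)).
Proof.
move=> Gp; elim/ltn_ind => m IHm m0.
have [m1|m1] := leqP m 1.
  have -> : m = 1%N by apply/eqP; rewrite eqn_leq m1.
  apply: (card_le_finite (card_cosets_le (A := [set tt]) (l := fun=> tt) _ _ _)).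
  - exact: multiples_subgroup.
  - by [].
  - by move=> x y _; exists (y - x).
  - exact: finite_set1.
have pp := pdiv_prime m1; set p := pdiv m in pp.
have /dvdnP[k mE] : (p %| m)%N by exact: pdiv_dvd.
have k0 : (0 < k)%N by move: m0; rewrite mE muln_gt0 => /andP[].
have km : (k < m)%N by rewrite mE -{1}(muln1 k) ltn_pmul2l// prime_gt1.
have /(finite_cosets_label (multiples_subgroup k))[a [l [la lk]]] := IHm k km k0.
have /(finite_cosets_label (multiples_subgroup p))[b [h [hb hp]]] := Gp p pp.
have /choice[r rP] : forall i, exists r, forall x, l x = i -> @multiples G k (x - r).
  move=> i; have [[r <-]|nr] := pselect (exists r, l r = i).
    by exists r => x /esym/lk.
  by exists 0 => x lx; case: nr; exists x.
have /choice[d dP] : forall x, exists d, d *+ k = x - r (l x).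
  by move=> x; have [d _ dE] := rP _ x erefl; exists d.
apply: (card_le_finite (card_cosets_le (A := `I_a `*` `I_b)
  (l := fun x => (l x, h (d x))) _ _ _)).
- exact: multiples_subgroup.
- by move=> x; split; [exact: la|exact: hb].
- move=> x y [lxy /hp[z _ zE]]; exists z => //.
  rewrite mE mulnC mulrnA zE mulrnBl !dP lxy.
  by rewrite opprB addrA subrK.
- by apply: finite_setX; exact: finite_II.
Qed.

(** The second hypothesis covers an infinite G/pG and is supplied by [subsets_cosets_multiples_le];
    the case that all G/pG are finite is treated here. *)
Lemma finite_index_subgroups_infinite : ~ almost_divisible G ->
  (forall p, prime p -> infinite_set (cosets (@multiples G p)) ->
    infinite_set (finite_index_subgroups G)) ->
  infinite_set (finite_index_subgroups G).
Proof.
move=> nadG infp Cfin; apply: nadG.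
have Gm : forall m, (0 < m)%N -> finite_set (cosets (@multiples G m)).
  by apply: finite_cosets_multiples => p /infp pinf; apply: contrapT => /pinf.
have /choice[f fP] : forall K, exists n, finite_index_subgroups G K ->
    (0 < n)%N /\ @multiples G n `<=` K.
  move=> K; have [CK|nCK] := pselect (finite_index_subgroups G K).
    by have [n n0 nK] := finite_index_multiples CK; exists n.
  by exists 0%N.
have /finite_seqP[s sE] := finite_image f Cfin.
(* A common multiple of the finitely many exponents [f K]. *)
pose N := (\max_(i <- s) i)`!.
have N0 : (0 < N)%N := fact_gt0 _.
have NK K : finite_index_subgroups G K -> @multiples G N `<=` K.
  move=> CK; have [n0 nK] := fP _ CK.
  apply: subset_trans nK => _ [x _ <-].
  have /dvdnP[q ->] : (f K %| N)%N.
    apply: dvdn_fact; rewrite n0 /=; apply: leq_bigmax_seq => //.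
    by have : [set` s] (f K) by rewrite -sE; exists K.
  by exists (x *+ q) => //; rewrite -mulrnA.
apply: finite_cosets_sub (Gm N N0) => //; try exact: multiples_subgroup.
  by case: (@max_divisibleP G).
apply: max_divisible_max; split; first exact: multiples_subgroup.
move=> m m0 x Nx.
(* NmG also has finite index, so it contains NG: x = Nmy is m times the element Ny of NG. *)
have [|y _ <-] := NK (@multiples G (N * m)) _ x Nx.
  by split; [exact: multiples_subgroup|apply: Gm; rewrite muln_gt0 N0].
by exists (y *+ N); [exists y|rewrite -mulrnA].
Qed.

End finite_index.

(** * A basis of G modulo p *)

Section count_seq.
Context {T : eqType}.
Implicit Types (s t : seq T) (n : nat) (X : pred T).

(** Multiplication by the scalar n for linear combinations written as sequences; modulo p, n = p - 1
    acts as -1. *)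
Definition repeat_seq n s := flatten (nseq n s).

Lemma count_repeat X n s : count X (repeat_seq n s) = (n * count X s)%N.
Proof.
by elim: n => //= n IHn; rewrite count_cat mulSn -IHn.
Qed.

Lemma all_repeat X n s : all X s -> all X (repeat_seq n s).
Proof. by move=> Xs; elim: n => //= n; rewrite /repeat_seq all_cat Xs. Qed.

Lemma dvdn_count p s X : (forall x, p %| count_mem x s)%N -> (p %| count X s)%N.
Proof.
move=> ps; rewrite -sum1_count big_mkcond -big_undup_iterop_count /=.
apply: dvdn_sum => x _; rewrite Monoid.iteropE iter_addn_0.
exact: dvdn_mull.
Qed.

End count_seq.

Lemma sum_repeat (G : zmodType) n (s : seq G) :
  \sum_(x <- repeat_seq n s) x = (\sum_(x <- s) x) *+ n.
Proof.
elim: n => [|n IHn]; first by rewrite big_nil mulr0n.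
by rewrite /repeat_seq /= big_cat/= mulrS -IHn.
Qed.

Section independent_mod_p.
Context {G : zmodType}.
Context (p : nat) (p_prime : prime p).
Implicit Types (B : set G) (s t : seq G).

Let P := @multiples G p.

Let sP : subgroup P := multiples_subgroup p.

(* Linear combinations modulo p are encoded as sums over sequences, the
   coefficient of b being the multiplicity of b modulo p. *)
Definition independent_mod B := forall s, all (mem B) s ->
  P (\sum_(x <- s) x) -> forall b, (p %| count_mem b s)%N.

Definition spanning_mod B := forall x,
  exists2 s, all (mem B) s & P (x - \sum_(y <- s) y).

Lemma sum_multiples s : (forall b, p %| count_mem b s)%N ->
  P (\sum_(x <- s) x).
Proof.
move=> ps; rewrite -big_undup_iterop_count /=.
apply: (@subgroup_sum _ P (undup s)
  (fun x => iterop (count_mem x s) +%R x 0)) => // x _.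
rewrite Monoid.iteropE iter_addr_0.
by have /dvdnP[k ->] := ps x; exists (x *+ k) => //; rewrite -mulrnA.
Qed.

Lemma max_independent_spanning B : independent_mod B ->
  (forall B', B `<` B' -> ~ independent_mod B') -> spanning_mod B.
Proof.
move=> indB maxB g; have [Bg|nBg] := pselect (B g).
  exists [:: g]; first by rewrite /= andbT; exact/mem_set.
  by rewrite big_seq1 subrr; exact: subgroup0.
have /existsNP[s /not_implyP[sB /not_implyP[Ps /existsNP[b /negP pb]]]] :
    ~ independent_mod (B `|` [set g]).
  by apply: maxB; split=> [x|BgB]; [left|apply/nBg/BgB; right].
set s' := [seq x <- s | x != g].
have s'B : all (mem B) s'.
  apply/allP => x; rewrite mem_filter /= => /andP[/eqP xg /(allP sB)].
  by move=> /set_mem[Bx|//]; exact/mem_set.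
have sumE : \sum_(x <- s) x = g *+ count_mem g s + \sum_(x <- s') x.
  rewrite (bigID (pred1 g)) /= big_filter; congr (_ + _).
  rewrite (eq_bigr (fun=> g)) => [|x /eqP//].
  by rewrite big_const_seq iter_addr_0.
(* If p divides the coefficient of g, dropping g leaves a relation inside B, against the
   independence of B. *)
have [pg|npg] := boolP (p %| count_mem g s)%N.
  have ps' : P (\sum_(x <- s') x).
    rewrite -(addKr (g *+ count_mem g s) (\sum_(x <- s') x)) -sumE addrC.
    apply: subgroupB => //; have /dvdnP[k ->] := pg.
    by exists (g *+ k) => //; rewrite -mulrnA.
  have [bg|bg] := eqVneq b g; first by rewrite bg pg in pb.
  have := indB _ s'B ps' b; rewrite count_filter.
  rewrite (eq_count (a2 := pred1 b)) => [|x /=]; first by rewrite (negPf pb).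
  by have [->|//] := eqVneq x b; rewrite bg.
have k0 : (0 < count_mem g s)%N by rewrite lt0n; apply: contraNneq npg => ->.
case: (egcdnP p k0) => k' q.
have -> : gcdn (count_mem g s) p = 1%N.
  by apply/eqP; rewrite -/(coprime _ _) coprime_sym prime_coprime.
(* Here k' inverts the coefficient of g modulo p, so g is -k' times the sum of [s'] modulo pG, and
   [p.-1] replaces -1. *)
move=> kE _; exists (repeat_seq (k' * p.-1) s'); first exact: all_repeat.
rewrite sum_repeat.
have -> : g - (\sum_(x <- s') x) *+ (k' * p.-1) =
    (\sum_(x <- s) x) *+ k' - (g *+ q + (\sum_(x <- s') x) *+ k') *+ p.
  have gE : g *+ count_mem g s *+ k' = g *+ q *+ p + g.
    by rewrite -!mulrnA [(count_mem g s * k')%N]mulnC kE mulrnDr.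
  have s'E : (\sum_(x <- s') x) *+ k' *+ p =
      (\sum_(x <- s') x) *+ (k' * p.-1) + (\sum_(x <- s') x) *+ k'.
    by rewrite -mulrnA -mulrnDr -{1}(prednK (prime_gt0 p_prime)) mulnS addnC.
  rewrite sumE !mulrnDl gE s'E -[_ + g + _]addrA opprD addrACA subrr add0r.
  by rewrite opprD addrACA subrr addr0.
by apply: subgroupB; [by []|exact: subgroupMn|eexists].
Qed.

Lemma max_independent :
  exists2 B, independent_mod B & spanning_mod B.
Proof.
have [F Find Ftot|B [indB maxB]] := @Zorn_bigcup G independent_mod; last first.
  by exists B => //; exact: max_independent_spanning.
(* A finite sequence from the union of a chain lies in one member; an empty chain leaves only the
   empty sequence. *)
move=> s sF; suff [->|[X FX sX]] : s = [::] \/ exists2 X, F X & all (mem X) s.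
- by move=> _ b; rewrite dvdn0.
- exact: Find FX _ sX.
elim: s sF => [|x s IHs] /=; first by left.
move=> /andP[/set_mem[X FX Xx] /IHs[->|[Y FY sY]]]; right.
  by exists X => //=; rewrite andbT; exact/mem_set.
have [XY|YX] := Ftot _ _ FX FY.
  by exists Y => //=; rewrite sY andbT; exact/mem_set/XY.
exists X => //=; apply/andP; split; first exact/mem_set.
by apply: sub_all sY => y /set_mem/YX/mem_set.
Qed.

Section basis.
Context (B : set G) (indB : independent_mod B) (spanB : spanning_mod B).

Let decomposition : {f : G -> seq G & forall x,
  all (mem B) (f x) /\ P (x - \sum_(y <- f x) y)}.
Proof.
apply: (@choice _ _ (fun x s => all (mem B) s /\ P (x - \sum_(y <- s) y))) => x.
by have [s sB Ps] := spanB x; exists s.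
Qed.

Let dec : G -> seq G := projT1 decomposition.

Let decB x : all (mem B) (dec x).
Proof. by have [] := projT2 decomposition x. Qed.

Let decP x : P (x - \sum_(y <- dec x) y).
Proof. by have [] := projT2 decomposition x. Qed.

(** The value at [x] of the functional G -> F_p that is the indicator of [X] on [B]. *)
Let coef (X : pred G) x := (count X (dec x) %% p)%N.

(** Any other representation [s] gives the same value: [dec x] followed by p - 1 copies of [s] sums
    into pG, so by independence all its multiplicities are divisible by p. *)
Let coefE X x s : all (mem B) s -> P (x - \sum_(y <- s) y) ->
  coef X x = (count X s %% p)%N.
Proof.
move=> sB Ps; apply/eqP.
rewrite -/(count X (dec x) == count X s %[mod p])%N.
have : (p %| count X (dec x ++ repeat_seq p.-1 s))%N.
  apply: dvdn_count; apply: indB.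
    by rewrite all_cat decB all_repeat.
  rewrite big_cat /= sum_repeat.
  have -> : \sum_(y <- dec x) y + (\sum_(y <- s) y) *+ p.-1 =
    (x - \sum_(y <- s) y) - (x - \sum_(y <- dec x) y) + (\sum_(y <- s) y) *+ p.
    rewrite -{2}(prednK (prime_gt0 p_prime)) mulrS addrA; congr (_ + _).
    by rewrite opprB addrAC subrK addrC subrK.
  apply: subgroupD => //; last by eexists.
  by apply: subgroupB => //; exact: decP.
rewrite count_cat count_repeat => /dvdnP[k kE].
rewrite -(eqn_modDr (p.-1 * count X s)) kE modnMl.
by rewrite -mulSn prednK ?prime_gt0// modnMr.
Qed.

Let coefB X x y : coef X (x - y) = ((coef X x + p.-1 * coef X y) %% p)%N.
Proof.
rewrite (@coefE X _ (dec x ++ repeat_seq p.-1 (dec y))).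
- by rewrite count_cat count_repeat modnDml -modnDmr -[in RHS]modnDmr modnMmr.
- by rewrite all_cat decB all_repeat.
rewrite big_cat /= sum_repeat.
have -> : x - y - (\sum_(z <- dec x) z + (\sum_(z <- dec y) z) *+ p.-1) =
    (x - \sum_(z <- dec x) z) - (y - \sum_(z <- dec y) z)
    - (\sum_(z <- dec y) z) *+ p.
  rewrite -[in RHS](prednK (prime_gt0 p_prime)) mulrS !opprD opprK !addrA.
  by congr (_ - _); rewrite addrK addrAC.
by apply: subgroupB => //; [apply: subgroupB; rewrite //; exact: decP|eexists].
Qed.

Let hyp (X : pred G) : set G := [set x | coef X x = 0%N].

Let hyp_finite_index X : finite_index_subgroups G (hyp X).
Proof.
have coefV x y : coef X x = coef X y -> coef X (y - x) = 0%N.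
  move=> xy; rewrite coefB xy -mulSn prednK ?prime_gt0//.
  by rewrite modnMr.
have sH : subgroup (hyp X).
  apply/subgroupP; split=> [|x y Hx Hy].
    by rewrite /hyp /= -(subrr 0); exact: coefV.
  by apply: coefV; rewrite Hx Hy.
split=> //; apply: card_le_finite (finite_II p).
apply: (card_cosets_le (l := coef X)) => // x; rewrite /coef /=.
exact/ltn_pmod/prime_gt0.
Qed.

Let coef_basis (X : pred G) b : B b -> coef X b = X b.
Proof.
move=> Bb; rewrite (@coefE X b [:: b]).
- rewrite /= addn0 modn_small//.
  by case: (X b); [exact: prime_gt1|exact: prime_gt0].
- by rewrite /= andbT; exact/mem_set.
- by rewrite big_seq1 subrr; exact: subgroup0.
Qed.

(** X is recovered from the kernel as the set of those elements of B that lie outside it. *)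
Lemma subsets_basis_le : subsets B #<= finite_index_subgroups G.
Proof.
apply: (@card_le_fun _ _ _ _ (fun X => hyp (fun b => b \in X))) => [X _|X Y XB YB].
  exact: hyp_finite_index.
have mem_basis (Z : set G) b : B b -> hyp (fun b => b \in Z) b <-> ~ Z b.
  move=> Bb; rewrite /hyp /= coef_basis//.
  split; first by move=> + Zb; rewrite /= (mem_set Zb).
  by move=> nZb; rewrite /= memNset.
move=> hXY; apply/seteqP; split=> b Zb; apply: contrapT.
  by move=> /(mem_basis Y _ (XB _ Zb)); rewrite -hXY => /(mem_basis X _ (XB _ Zb)).
by move=> /(mem_basis X _ (YB _ Zb)); rewrite hXY => /(mem_basis Y _ (YB _ Zb)).
Qed.

Lemma cosets_le_seq_basis :
  cosets (@multiples G p) #<= [set s | all (mem B) s].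
Proof.
apply: (card_cosets_le (l := dec)) => // x y xy.
have -> : y - x = (y - \sum_(z <- dec y) z) - (x - \sum_(z <- dec x) z).
  by rewrite xy opprB addrA subrK.
by apply: subgroupB => //; exact: decP.
Qed.

(** An element killed by all coordinate functionals lies in pG; for a finite B these kernels have an
    intersection of finite index. *)
Lemma finite_basis : finite_set B -> finite_set (cosets (@multiples G p)).
Proof.
move=> /finite_seqP[r rE].
have [K [sK fK] KH] : exists2 K, finite_index_subgroups G K &
    forall b, b \in r -> K `<=` hyp (pred1 b).
  elim: {rE} r => [|b r [K CK KH]].
    by exists setT => //; exact: finite_index_subgroupsT.
  exists (hyp (pred1 b) `&` K); first exact: finite_index_subgroupsI.
  by move=> c; rewrite inE => /orP[/eqP ->|/KH Kc] x [] // _ /Kc.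
apply: finite_cosets_sub (fK) => // x Kx.
rewrite -[x](subrK (\sum_(y <- dec x) y)); apply: subgroupD => //; first exact: decP.
apply: sum_multiples => b; have [br|nbr] := boolP (b \in r).
  by apply/eqP; exact: (KH b br x Kx).
have -> : count_mem b (dec x) = 0%N; last exact: dvdn0.
apply/count_memPn/negP => /(allP (decB x))/set_mem.
by rewrite rE /= (negPf nbr).
Qed.

End basis.

(** B is infinite by [finite_basis], so there are only |B| finite sequences in B, and |G/pG| <=
    |B|. *)
Lemma subsets_cosets_multiples_le :
  infinite_set (cosets (@multiples G p)) ->
  infinite_set (finite_index_subgroups G) /\
  subsets (cosets (@multiples G p)) #<= finite_index_subgroups G.
Proof.
move=> Ginf; have [B indB spanB] := max_independent.
have Binf : infinite_set B by move/(finite_basis indB spanB).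
split.
  apply: contra_not (infinite_subsets Binf).
  exact/card_le_finite/subsets_basis_le.
apply: card_le_trans (subsets_basis_le indB spanB).
apply: card_le_subsets; apply: card_le_trans (card_le_seq Binf).
exact: cosets_le_seq_basis.
Qed.

End independent_mod_p.

(** * Coding the subgroups of finite index *)

Section upper_bound.
Context {G : zmodType}.
Implicit Types (K E : set G).

(** With n = kp, write x = e + py and, by induction, y = e' + kz; then x = (e + pe') + nz. *)
Lemma generate_mod E n : subgroup E -> (0 < n)%N ->
  (forall p, p \in primes n ->
    forall x, exists2 e, E e & @multiples G p (x - e)) ->
  forall x, exists2 e, E e & @multiples G n (x - e).
Proof.
move=> sE; elim/ltn_ind: n => n IHn n0 En x.
have [n1|n1] := leqP n 1.
  have -> : n = 1%N by apply/eqP; rewrite eqn_leq n1.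
  by exists 0; [exact: subgroup0|exists x; rewrite ?subr0].
have pp := pdiv_prime n1; set p := pdiv n in pp.
have /dvdnP[k nE] : (p %| n)%N by exact: pdiv_dvd.
have k0 : (0 < k)%N by move: n0; rewrite nE muln_gt0 => /andP[].
have kn : (k < n)%N by rewrite nE -{1}(muln1 k) ltn_pmul2l// prime_gt1.
have [|e Ee [y _ yE]] := En p _ x; first by rewrite mem_primes pp n0 pdiv_dvd.
have [q qk z|e' Ee' [z _ zE]] := IHn k kn k0 _ y.
  apply: En; move: qk; rewrite !mem_primes n0 k0 /= => /andP[-> qk].
  by rewrite nE dvdn_mulr.
exists (e + e' *+ p); first by apply: subgroupD => //; exact: subgroupMn.
by exists z => //; rewrite nE mulrnA zE mulrnBl yE opprD addrA.
Qed.

(* l enumerates the cosets of K, and op is the subtraction of G / K. *)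
Definition labels K (m n : nat) (l : G -> nat) (op : nat -> nat -> nat) :=
  [/\ (0 < n)%N, @multiples G n `<=` K, (forall x, (l x < m)%N),
      (forall x y, l x = l y <-> K (y - x)) &
      (forall x y, op (l x) (l y) = l (x - y))].

Lemma finite_index_labels K : finite_index_subgroups G K ->
  exists m n l op, labels K m n l op.
Proof.
move=> CK; have [n n0 nK] := finite_index_multiples CK.
case: CK => sK /(finite_cosets_label sK)[m [l [lm lK]]].
(* [r] picks an element with a given label, and 0 for numbers that are not labels. *)
have /choice[r rP] : forall i, exists r, forall x, l x = i -> l r = i.
  move=> i; have [[r lr]|nr] := pselect (exists r, l r = i).
    by exists r => x.
  by exists 0 => x lx; case: nr; exists x.
exists m, n, l, (fun i j => l (r i - r j)); split=> // x y.
have rl z : K (r (l z) - z) by apply/lK/esym; exact: (rP _ z).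
apply/esym/lK; have -> : r (l x) - r (l y) - (x - y) =
    (r (l x) - x) - (r (l y) - y).
  by rewrite !opprB [y - x]addrC addrACA [y - _]addrC.
exact: subgroupB.
Qed.

(* x |-> x + K is a homomorphism to the finite group G / K, of exponent
   dividing n; it is determined by its values on transversals of the pG with
   p | n, since these generate G modulo nG. *)
Lemma labels_inj K K' m n l l' op op' (rep : nat -> set G -> G) :
  labels K m n l op -> labels K' m n l' op' ->
  (forall p c, cosets (@multiples G p) c -> c (rep p c)) ->
  l 0 = l' 0 ->
  (forall i j, (i < m)%N -> (j < m)%N -> op i j = op' i j) ->
  (forall p c, p \in primes n -> cosets (@multiples G p) c ->
    l (rep p c) = l' (rep p c)) ->
  K = K'.
Proof.
move=> [n0 nK lm lK opE] [_ nK' lm' lK' opE'] repP l0 opop ll'.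
(* Since [op] and [op'] agree on labels and [l 0 = l' 0], the points where the two numberings agree
   form a subgroup. *)
pose E := [set x | l x = l' x].
have sE : subgroup E.
  apply/subgroupP; split=> // x y Ex Ey.
  by rewrite /E /= -opE -opE' -Ex -Ey; exact: opop.
have nE : @multiples G n `<=` E.
  move=> x nx; have nNx : @multiples G n (0 - x).
    rewrite sub0r; apply: subgroupN => //; exact: multiples_subgroup.
  by rewrite /E /= ((lK x 0).2 (nK _ nNx)) ((lK' x 0).2 (nK' _ nNx)).
have ET x : E x.
  have [p pn y|e Ee nxe] := generate_mod sE n0 _ x.
    have cy : cosets (@multiples G p) (translate (@multiples G p) y) by exists y.
    exists (rep p (translate (@multiples G p) y)); first exact: ll'.
    rewrite -opprB; apply: subgroupN; first exact: multiples_subgroup.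
    by apply/mem_translate; exact: repP p _ cy.
  by rewrite -(subrK e x); apply: subgroupD => //; exact: nE.
apply/seteqP; split=> x; rewrite -(subr0 x).
  by move=> /lK lx; apply/lK'; rewrite -l0 lx; exact: ET.
by move=> /lK' lx; apply/lK; rewrite l0 lx; apply/esym; exact: ET.
Qed.

Lemma card_finite_index_le T (S : set T) :
  (forall p, prime p -> subsets (cosets (@multiples G p)) #<= S) ->
  finite_index_subgroups G #<= [set: nat] `*` S.
Proof.
move=> pS; have sub0 p : subsets (cosets (@multiples G p)) !=set0.
  by exists set0 => x [].
have [f2 [f2S _]] := card_le_funP (sub0 2%N) (pS 2%N isT).
have S0 : S (f2 set0) by apply: f2S => x [].
set M := [set: nat] `*` S.
(* The factor omega makes the set of codes infinite even if [S] is finite. *)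
have Minf : infinite_set M.
  apply/infiniteP; apply: (@card_le_fun _ _ _ _ (fun n => (n, f2 set0))) => //.
  by move=> x y _ _ [].
have /choice[i iP] : forall p, exists f : set (set G) -> T, prime p ->
    (forall X, subsets (cosets (@multiples G p)) X -> S (f X)) /\
    (forall X Y, subsets (cosets (@multiples G p)) X ->
      subsets (cosets (@multiples G p)) Y -> f X = f Y -> X = Y).
  move=> p; have [pp|npp] := pselect (prime p); last by exists (fun=> f2 set0).
  by have [f fP] := card_le_funP (sub0 p) (pS p pp); exists f.
have /choice[rep repP] : forall c : set G, exists r, c !=set0 -> c r.
  move=> c; have [[r cr]|nc] := pselect (c !=set0); first by exists r.
  by exists 0.
(* For fixed p, the values of [l] on the transversal are recorded by its level sets, each a subset
   of G/pG and hence coded in [S]. *)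
pose X (l : G -> nat) (p j : nat) : set (set G) := [set c | cosets (@multiples G p) c /\ l (rep c) = j].
pose pairs s t : seq (nat * nat) := [seq (a, b) | a <- s, b <- t].
pose table m (op : nat -> nat -> nat) :=
  [seq op q.1 q.2 | q <- pairs (iota 0 m) (iota 0 m)].
(* The position in the list identifies p and j; the component 0 is padding that puts the entries
   into [M]. *)
pose values m n (l : G -> nat) :=
  [seq (0%N, i q.1 (X l q.1 q.2)) | q <- pairs (primes n) (iota 0 m)].
apply: card_le_trans (card_le_nat_setX Minf).
apply: card_le_trans (card_le_setX (card_lexx _) (card_le_seq Minf)).
apply: (@card_le_rel _ _ _ _ (fun K c => exists m n l op,
  [/\ labels K m n l op, c.1 = pickle (m, n, l 0, table m op) &
      c.2 = values m n l])).
  move=> K /finite_index_labels[m [n [l [op lab]]]].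
  exists (pickle (m, n, l 0, table m op), values m n l); last by exists m, n, l, op.
  split=> //=; rewrite all_map; apply/allP => _ /allpairsP[[p j] /= [pn _ ->]].
  apply/mem_set; split=> //=; have pp : prime p.
    by move: pn; rewrite mem_primes => /andP[].
  by apply: (iP p pp).1 => c [].
move=> K K' [t s] _ _ _ [m [n [l [op [lab /= -> ->]]]]].
move=> [m' [n' [l' [op' [lab' /= /(pcan_inj pickleK)[]]]]]].
move=> mm nn l0; subst m' n'; rewrite /table /values.
move=> /eq_in_map opop /eq_in_map XX.
apply: (@labels_inj K K' m n l l' op op' (fun=> rep)) => //.
- move=> p _ [x _ <-]; apply: repP; exists x.
  exact/translate_refl/multiples_subgroup.
- move=> a b am bm; apply: (opop (a, b)).
  by apply/allpairsP; exists (a, b); rewrite !mem_iota.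
move=> p c pn pc; have pp : prime p.
  by move: pn; rewrite mem_primes => /andP[].
have [_ _ lm _ _] := lab.
have /XX[/(iP p pp).2] : (p, l (rep c)) \in pairs (primes n) (iota 0 m).
  by apply/allpairsP; exists (p, l (rep c)); rewrite mem_iota /= pn lm.
(* [c] lies in its own level set for [l]; equality with the level set for [l'] gives the same label
   there. *)
move=> XX'; have : X l p (l (rep c)) c by [].
by rewrite XX' => [[_ ->]|? []|? []].
Qed.

End upper_bound.

(** * Character and weight *)

Section character_weight.
Context {G : zmodType}.
Implicit Types H K : set G.

(** A subgroup containing H is determined by its image in G/H, a subset of a finite set. *)
Lemma finite_supgroups H : finite_index_subgroups G H ->
  finite_set [set K | subgroup K /\ H `<=` K].
Proof.
move=> [sH fH]; apply: card_le_finite (finite_subsets fH).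
apply: (@card_le_fun _ _ _ _ (fun K => translate H @` K)) => [K _ _ [x _ <-]|].
  by exists x.
have sub K K' : subgroup K' -> H `<=` K' ->
    translate H @` K = translate H @` K' -> K `<=` K'.
  move=> sK' HK' KK' x Kx.
  have [y K'y /(translate_eqP _ _ sH) Hxy] : (translate H @` K') (translate H x).
    by rewrite -KK'; exists x.
  by rewrite -(subrK y x); apply: subgroupD => //; exact: HK'.
by move=> K K' [sK HK] [sK' HK'] KK'; apply/seteqP; split; apply: sub.
Qed.

Context (Cinf : infinite_set (finite_index_subgroups G)).

Lemma nbhs_basis_card_ge (B : set (set (profinite G))) :
  nbhs_basis (0 : profinite G) B -> finite_index_subgroups G #<= B.
Proof.
move=> [Bnbhs Bbase].
have /choice[h hP] : forall U : set G, exists H, B U ->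
    finite_index_subgroups G H /\ H `<=` U.
  move=> U; have [BU|nBU] := pselect (B U); last by exists U.
  have [H CH HU] := Bnbhs U BU; exists H => _.
  by split=> //; move: HU; rewrite translate0.
have CB K : finite_index_subgroups G K -> exists2 U, B U & h U `<=` K.
  move=> CK; have [U BU UK] : filter_from B id K.
    by apply: Bbase; exists K => //; rewrite translate0.
  by exists U => //; have [_ hU] := hP U BU; exact: subset_trans UK.
(* A finite B would make C(G) a finite union of the finite sets of [finite_supgroups]. *)
have Binf : infinite_set B.
  move=> Bfin; apply: Cinf.
  apply: (@sub_finite_set _ _
    (\bigcup_(U in B) [set K | subgroup K /\ h U `<=` K])).
    by move=> K CK; have [U BU hU] := CB K CK; exists U => //; case: CK.
  by apply: bigcup_finite => // U BU; apply: finite_supgroups; have [] := hP U BU.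
have /choice[idx idxP] : forall U : set G, exists f : set G -> nat, B U ->
    forall K K', subgroup K -> subgroup K' -> h U `<=` K -> h U `<=` K' ->
    f K = f K' -> K = K'.
  move=> U; have [BU|nBU] := pselect (B U); last by exists (fun=> 0%N).
  have /finite_supgroups/finite_set_countable := (hP U BU).1.
  move=> /countable_injP[f finj]; exists f => _ K K' sK sK' hK hK'.
  by apply: finj; apply/mem_set.
(* K is coded by some U in B with [h U] inside K and by the number of K among the subgroups
   containing [h U]. *)
apply: card_le_trans (card_le_nat_setX Binf).
apply: (@card_le_rel _ _ _ _
  (fun K c => h c.2 `<=` K /\ idx c.2 K = c.1)) => [K CK|].
  by have [U BU hU] := CB K CK; exists (idx U K, U).
move=> K K' [n U] [sK _] [sK' _] [_ BU] /= [hK <-] [hK' /esym].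
exact: idxP.
Qed.

Lemma is_character_profinite :
  is_character (0 : profinite G) (finite_index_subgroups G).
Proof.
split; last exact: nbhs_basis_card_ge.
exists (finite_index_subgroups G); last exact: card_eqxx.
exact: nbhs_basis_profinite.
Qed.

Lemma is_weight_profinite :
  is_weight (profinite G) (finite_index_subgroups G).
Proof.
split; last first.
  move=> B [Bopen Bbase].
  (* The members of a base that contain 0 form a base of neighborhoods of 0, so the character is a
     lower bound. *)
  apply: (@card_le_trans _ _ _ [set U | B U /\ U (0 : profinite G)]).
    apply: nbhs_basis_card_ge; split; last exact: Bbase.
    by move=> U [BU U0]; apply: open_nbhs_nbhs; split => //; exact: Bopen.
  by apply: subset_card_le => U [].
(* The cosets of the finite-index subgroups form a base; each is coded by its subgroup and its
   number among the finitely many cosets of that subgroup. *)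
pose B := \bigcup_(H in finite_index_subgroups G) cosets H.
have BC H : finite_index_subgroups G H -> B H.
  by move=> CH; exists H => //; exists 0 => //; rewrite translate0.
exists B; last first.
  apply/card_eqPle; split; last exact: subset_card_le.
  apply: card_le_trans (card_le_nat_setX Cinf).
  have /choice[l lP] : forall H, exists l : set G -> nat,
      finite_index_subgroups G H -> {in cosets H &, injective l}.
    move=> H; have [CH|nCH] := pselect (finite_index_subgroups G H).
      by have /finite_set_countable/countable_injP[l linj] := CH.2; exists l.
    by exists (fun=> 0%N).
  apply: (@card_le_rel _ _ _ _
    (fun c t => cosets t.2 c /\ l t.2 c = t.1)) => [c [H CH Hc]|].
    by exists (l H c, H).
  move=> c c' [n H] _ _ [_ CH] /= [Hc <-] [Hc' /esym].
  by apply: lP => //; exact/mem_set.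
split=> [_ [H CH [x _ <-]]|x A [H CH HA]].
  rewrite openE => y Hxy; exists H => //.
  have -> // : translate H x = translate H y.
  by apply/translate_eqP; [case: CH|exact/mem_translate].
exists (translate H x) => //; split; first by exists H => //; exists x.
by apply: translate_refl; case: CH.
Qed.

End character_weight.

Unset Implicit Arguments.

Theorem theorem3p3 (G : zmodType) (hG : ~ almost_divisible G) :
  exists (T : Type) (S : set T),
    [/\ is_card_sup [set p : nat | prime p]
          (fun p => subsets (cosets (@multiples G p))) S,
        is_character (0 : profinite G) (finite_index_subgroups G),
        is_weight (profinite G) (finite_index_subgroups G)
      & finite_index_subgroups G #= [set: nat] `*` S].
Proof.
have Cinf : infinite_set (finite_index_subgroups G).
  apply: finite_index_subgroups_infinite => // p pp.
  by move=> /(subsets_cosets_multiples_le pp)[].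
have [T [S [leS Sle]]] := card_sup_exists [set p : nat | prime p]
  (fun p => subsets (cosets (@multiples G p))).
exists T, S; split=> //.
- exact: is_character_profinite.
- exact: is_weight_profinite.
apply/card_eqPle; split; first exact: card_finite_index_le.
apply: card_le_trans (card_le_nat_setX Cinf).
apply: card_le_setX (card_lexx _) _; apply: Sle => p pp.
(* For a finite G/pG the power set is finite, hence below the infinite C(G). *)
have [fin|inf] := pselect (finite_set (cosets (@multiples G p))).
  exact/finite_card_le/Cinf/finite_subsets.
by have [] := subsets_cosets_multiples_le pp inf.
Qed.
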